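(* (i) Let $f\in L^1(\mathbb{R})$ be a simple function (i.e. a measurable function taking only finitely many values). If $x\in\mathbb{R}$ is a point of discontinuity of $\mathcal{M}f$, then for every $r>0$ there exists $y\in (x-r,x+r)$ such that $y$ is not a Lebesgue point of $f$. (ii) Conversely, let $f\in L^1(\mathbb{R})$ be a characteristic function (i.e. $f=\chi_A$ for a measurable set $A\subseteq\mathbb{R}$). If $x\in\mathbb{R}$ is not a Lebesgue point of $f$, then for every $r>0$ there exists $y\in (x-r,x+r)$ such that $\mathcal{M}f$ is discontinuous at $y$.
   Context: For $f\in L^1(\mathbb{R})$, $x\in\mathbb{R}$ and $r>0$, put $\mathcal{A}_r f(x):=\frac{1}{2r}\int_{-r}^{r} f(x+y)\,dy$. The (centered) Hardy-Littlewood maximal function is $\mathcal{M}f(x):=\sup_{r>0}\mathcal{A}_r|f|(x)\in[0,\infty]$. A point $x\in\mathbb{R}$ is called a Lebesgue point of $f\in L^1_{loc}(\mathbb{R})$ if there exists a number $c(x)$ (not required to equal $f(x)$) such that $\lim_{r\rightarrow 0^+} \frac{1}{2r}\int_{-r}^{r}|f(x+t)-c(x)|\,dt=0$. *)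

(* Defs.v *)
From HB Require Import structures.
From mathcomp Require Import all_boot all_order all_algebra.
From mathcomp Require Import all_classical all_reals all_analysis.

Set Implicit Arguments.
Unset Strict Implicit.
Unset Printing Implicit Defensive.

Import Order.TTheory GRing.Theory Num.Theory.
Import numFieldNormedType.Exports.
Export numFieldNormedType.Exports.

(* The carrier of [R] with the sigma-algebra of Lebesgue-measurable sets
   (Caratheodory's, i.e. the completion of the Borel one).  The library's
   [lebesgue_measure], hence also [iavg] and [HL_maximal], only knows the Borel
   sigma-algebra, which would exclude non-Borel functions and sets. *)
Definition lebesgueR (R : realType) : measurableType _ :=
  caratheodory_type (@wlength R idfun)^*%mu.

Section HardyLittlewood.
Context {R : realType}.
Implicit Types (f : R -> R) (x r : R).
Local Open Scope classical_set_scope.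
Local Open Scope ring_scope.

Local Notation lambda := (@completed_lebesgue_measure R).

Definition L1 f : Prop := lambda.-integrable setT (EFin \o f).

(* Extended-real valued: when [f] is nonnegative but not integrable on
   [[x - r, x + r]] the value is [+oo]. *)
Definition avg f x r : \bar R :=
  ((2 * r)^-1%:E * \int[lambda]_(y in `[(- r)%R, r]) (f (x + y))%:E)%E.

Definition maximal f x : \bar R :=
  ereal_sup [set avg (fun t => `|f t|) x r | r in [set r | 0 < r]].

(* Weaker than the library's [lebesgue_pt f x], which forces [c = f x]. *)
Definition lebesgue_point f x : Prop :=
  exists c : R, avg (fun t => `|f t - c|) x r @[r --> 0^'+] --> 0%E.

End HardyLittlewood.

(* Main.v *)
Require Import Defs.
From mathcomp Require Import all_boot all_order all_algebra.
From mathcomp Require Import all_classical all_reals all_analysis.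
From mathcomp Require Import measurable_realfun ring lra.
Import HBSimple.
Import Order.TTheory GRing.Theory Num.Theory.
Local Open Scope classical_set_scope.
Local Open Scope ring_scope.

(** Both parts rest on one fact about a measurable set E of reals
    ([intermediate_density]): if neither E nor its complement is null in an
    interval J, then J contains an interior point z such that, for all small s,
    the proportion of E in [z - s, z + s] lies between 1/4 and 3/4.  Put h(t) = |E ∩ ]a, t]| - t/2.  If h were increasing,
    the complement of E would have density at most 1/2 in every subinterval of
    J, and covering it by intervals of nearly optimal total length shows that it
    is null ([density_lt1_null]); likewise h cannot be decreasing.  So the
    continuous function h has an interior extremum z.  At a maximum, E has
    density at least 1/2 on every short interval to the left of z and at most
    1/2 on every short interval to the right; at a minimum it is the reverse.
    Averaging the two sides gives the bounds 1/4 and 3/4.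

    Characteristic functions.  If x is not a Lebesgue point of the indicator of
    A, then near x neither A nor its complement is null (otherwise c = 0 or
    c = 1 would do), so there is such a z for A.  The maximal function is
    strictly below 1 at z: averages at small radii are at most 3/4, larger
    intervals contain a fixed amount of the complement of A, and averages at very
    large radii are small because A has finite measure ([maximal_indic_lt1]).  If the maximal function were
    continuous at z it would stay below some theta < 1 around z, so A would have
    density at most theta in all small intervals near z, hence be null near z,
    against the lower bound 1/4.

    Simple functions.  Suppose that all points near x are Lebesgue points of f.
    A level set E of f cannot have a point z as above: the values of f are
    separated, so any constant c stays away from f on E or on its complement,
    and both occupy at least a quarter of the small intervals around z.  So each
    level set is null or conull near x; as the levels are finitely many, one is
    conull and f is a.e. constant near x ([locally_ae_constant]).  Averages of
    |f| at small radii are then constant near x, whereas those at radii bounded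
    below vary by a factor close to 1 when the centre moves a little, because
    [z - s, z + s] lies in [z' - (s + d), z' + (s + d)] for d = |z - z'|.  Hence
    the maximal function varies continuously at x ([maximal_continuous_at]). *)

Set Implicit Arguments.
Unset Strict Implicit.
Unset Printing Implicit Defensive.

(** * Interior extrema of non-monotone functions *)

Section Extremum.
Context {R : realType}.
Implicit Types (h : R -> R) (a b : R).

(** A continuous function without interior extrema is injective, as in Rolle's
    theorem, hence strictly monotone; a strict increase and a strict decrease
    exclude this. *)
Lemma nonmonotone_local_extremum h a b u v u' v' :
  {within `[a, b], continuous h} ->
  a <= u -> u < v -> v <= b -> h u < h v ->
  a <= u' -> u' < v' -> v' <= b -> h v' < h u' ->
  exists p z q, [/\ a <= p, p < z, z < q, q <= b &
    (forall t, p <= t <= q -> h t <= h z) \/ (forall t, p <= t <= q -> h z <= h t)].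
Proof.
move=> hc au uv vb huv au' uv' vb' huv'; apply: contrapT => noext.
have noext' p q : a <= p -> q <= b -> forall z, p < z < q ->
    ~ (forall t, p <= t <= q -> h t <= h z) /\ ~ (forall t, p <= t <= q -> h z <= h t).
  move=> ap qb z /andP[pz zq]; split=> ext; apply: noext; exists p, z, q; split => //;
    by [left|right].
have inj : {in `[a, b] &, injective h}.
  move=> s t; wlog st : s t / s < t.
    move=> wl sI tI hst; case: (ltgtP s t) => // st; first exact: wl.
    by apply/esym/wl.
  rewrite !in_itv /= => /andP[as_ _] /andP[_ tb] hst; exfalso.
  have hc' : {within `[s, t], continuous h}.
    apply: continuous_subspaceW hc => y /=; rewrite !in_itv /= => /andP[sy yt].
    by rewrite (le_trans as_ sy) (le_trans yt tb).
  have [c cI cmax] := EVT_max (ltW st) hc'.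
  have [d dI dmin] := EVT_min (ltW st) hc'.
  move: cI dI; rewrite !in_itv /= => /andP[sc ct] /andP[sd dt].
  have ext := noext' s t as_ tb.
  have cmax' y : s <= y <= t -> h y <= h c by move=> ?; apply: cmax; rewrite in_itv.
  have dmin' y : s <= y <= t -> h d <= h y by move=> ?; apply: dmin; rewrite in_itv.
  have hcs : h c = h s.
    have [->//|sc'] := eqVneq c s; have [->//|ct'] := eqVneq c t.
    by case: (ext c _) => //; rewrite !lt_neqAle eq_sym sc' sc ct' ct.
  have hds : h d = h s.
    have [->//|sd'] := eqVneq d s; have [->//|dt'] := eqVneq d t.
    by case: (ext d _) => //; rewrite !lt_neqAle eq_sym sd' sd dt' dt.
  (* Both extreme values are those at the endpoints, so h is constant on
     [s, t] and the midpoint is an interior maximum. *)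
  have st2 : s < (s + t) / 2 < t by rewrite !midf_lt.
  case: (ext _ st2) => + _; apply => y /cmax' hy.
  by apply: (le_trans hy); rewrite hcs -hds; apply: dmin'; move: st2 => /andP[]; lra.
have mem y : a <= y -> y <= b -> y \in `[a, b] by rewrite in_itv /= => -> ->.
have uI : u \in `[a, b] by apply: mem; lra.
have vI : v \in `[a, b] by apply: mem; lra.
have uI' : u' \in `[a, b] by apply: mem; lra.
have vI' : v' \in `[a, b] by apply: mem; lra.
case: (itv_continuous_inj_mono hc inj) => mono.
- by have := lt_trans huv' (mono _ _ uI' vI' uv'); rewrite ltxx.
- by have := lt_trans huv (mono _ _ vI uI uv); rewrite ltxx.
Qed.

Lemma lipschitz_within_continuous h a b :
  (forall s t, a <= s -> s <= t -> t <= b -> `|h t - h s| <= t - s) ->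
  {within `[a, b], continuous h}.
Proof.
move=> lip; apply/subspace_continuousP => x xab.
apply/cvgrPdist_le => e e0; rewrite near_withinE; near=> y => yab.
move: xab yab; rewrite /mkset !in_itv /= => /andP[ax xb] /andP[ay yb].
have xye : `|x - y| <= e by near: y; exact: cvgr_dist_le.
apply: le_trans xye; have [xy|yx] := leP x y.
  by rewrite distrC [leRHS]distrC [leRHS]ger0_norm ?subr_ge0//; exact: lip.
by rewrite [leRHS]ger0_norm ?subr_ge0 ?(ltW yx)//; apply: lip => //; exact: ltW.
Unshelve. all: by end_near.
Qed.

End Extremum.

Section MaximalFunction.
Context {R : realType}.
Implicit Types (a b u v x z s : R) (A E : set (lebesgueR R)).
Local Notation lambda := (@completed_lebesgue_measure R).

(** * The completed Lebesgue measure: intervals and translations *)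

Lemma measurable_itvL (i : interval R) : measurable ([set` i] : set (lebesgueR R)).
Proof. by apply: sub_caratheodory; exact: measurable_itv. Qed.

Lemma lambda_itv (i : interval R) :
  lambda [set` i] = (if i.1 < i.2 then (i.2 : \bar R) - i.1 else 0)%E.
Proof. exact: lebesgue_measure_itv. Qed.

Lemma le_lambda : {homo lambda : A B / A `<=` B >-> (A <= B)%E}.
Proof. exact: (@le_mu_ext _ _ _ (@wlength R idfun)). Qed.

Lemma lambda_ge0 E : (0 <= lambda E)%E.
Proof. exact: mu_ext_ge0. Qed.

Lemma lambda_oc a b : a <= b -> lambda `]a, b] = (b - a)%:E.
Proof.
move=> ab; rewrite lambda_itv /= lte_fin; case: ltgtP ab => // -> _.
by rewrite subrr.
Qed.

(** Translating a cover by half-open intervals gives a cover of the same total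
    length; this compares outer measures, so it holds for every set. *)
Lemma le_lambda_shift x E : (lambda (+%R x @^-1` E) <= lambda E)%E.
Proof.
apply: le_ereal_inf_tmp => _ [F [mF EF] <-].
move: mF => /(_ _)/cid2-/all_sig[p]/all_and2[_]/(_ _)/esym FE.
pose G k : set (ocitv_type R) := `](p k).1 - x, (p k).2 - x]%classic.
apply: (@le_trans _ _ (\sum_(0 <= k <oo) wlength idfun (G k))%E).
  apply: ereal_inf_lbound; exists G => //; split => [k|y Ey]; first exact: is_ocitv.
  have [k _ Fk] := EF _ Ey; exists k => //.
  by move: Fk; rewrite FE /G /= !in_itv /= ltrBlDl lerBrDl.
apply: lee_nneseries => [k _ _|k _]; first exact: (wlength_ge0 idfun).
rewrite FE /G wlength_itv [leRHS](wlength_itv idfun `](p k).1, (p k).2]) /=.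
rewrite !lte_fin ltrD2r; case: ifP => // _.
by rewrite lee_fin opprB addrA subrK.
Qed.

Lemma lambda_shift x E : lambda (+%R x @^-1` E) = lambda E.
Proof.
apply/eqP; rewrite eq_le le_lambda_shift /=.
have := le_lambda_shift (- x) (+%R x @^-1` E).
by congr (lambda _ <= _)%E; apply/funext => y /=; rewrite addrA subrr add0r.
Qed.

(** Carathéodory's criterion only involves the outer measure, so it inherits
    invariance under translation. *)
Lemma measurable_shift x E : measurable E ->
  measurable (+%R x @^-1` E : set (lebesgueR R)).
Proof.
move=> mE; rewrite -[measurable _]/((@wlength R idfun)^*%mu.-caratheodory _).
move=> X; have : lambda _ = (lambda _ + lambda _)%E := mE (+%R (- x) @^-1` X).
rewrite -[_^*%mu]/lambda.
rewrite -[X in X = _ -> _](lambda_shift x).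
rewrite -[X in _ = (X + _)%E -> _](lambda_shift x).
rewrite -[X in _ = (_ + X)%E -> _](lambda_shift x).
suff K : +%R x @^-1` (+%R (- x) @^-1` X) = X.
  by rewrite preimage_setI K preimage_setI preimage_setC K.
by apply/funext => y; rewrite /preimage /= addKr.
Qed.

Lemma integral_shift (g : R -> R) x (s : R) :
  measurable_fun [set: lebesgueR R] (g : lebesgueR R -> R) -> (forall t, 0 <= g t) ->
  (\int[lambda]_(y in `[(- s)%R, s]) (g (x + y))%:E =
   \int[lambda]_(y in `[(x - s)%R, (x + s)%R]) (g y)%:E)%E.
Proof.
move=> mg g0.
have mphi : measurable_fun [set: lebesgueR R] (+%R x : lebesgueR R -> lebesgueR R).
  by move=> _ Y mY; rewrite setTI; exact: measurable_shift.
rewrite [RHS](@eq_measure_integral _ _ _ _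
  (pushforward lambda (+%R x : lebesgueR R -> lebesgueR R)) lambda); last first.
  by move=> A mA _; exact/esym/lambda_shift.
rewrite (ge0_integral_pushforward mphi); last 3 first.
- exact: measurable_itvL.
- by apply/measurable_EFinP; exact: measurable_funTS.
- by move=> y _; rewrite lee_fin.
congr (integral _ _ _); apply/seteqP; split => y /=; rewrite !in_itv /=.
  by move=> /andP[]; lra.
by move=> /andP[]; lra.
Qed.

(** * Mass of a set in an interval, and points of intermediate density *)

Lemma lambda_setI_itv_fin E (a b : R) : lambda (E `&` `]a, b]) \is a fin_num.
Proof.
rewrite ge0_fin_numE ?lambda_ge0//.
apply: (@le_lt_trans _ _ (lambda `]a, b])); first by apply: le_lambda; exact: subIsetr.
by rewrite lambda_itv /=; case: ifP => _; rewrite ?ltry.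
Qed.

(** Half-open intervals make the mass additive under concatenation. *)
Definition mass E a b : R := fine (lambda (E `&` `]a, b])).

Lemma massE E a b : lambda (E `&` `]a, b]) = (mass E a b)%:E.
Proof. by rewrite fineK// lambda_setI_itv_fin. Qed.

Lemma mass_ge0 E a b : 0 <= mass E a b.
Proof. by rewrite -lee_fin -massE lambda_ge0. Qed.

Lemma mass_setC E a b : measurable E -> a <= b -> mass E a b + mass (~` E) a b = b - a.
Proof.
move=> mE ab; apply: EFin_inj; rewrite EFinD -!massE -lambda_oc//.
have -> : lambda `]a, b] = (lambda _ + lambda _)%E := mE `]a, b]%classic.
by rewrite ![`]a, b]%classic `&` _]setIC.
Qed.

Lemma mass_le E a b : a <= b -> mass E a b <= b - a.
Proof.
by move=> ab; rewrite -lee_fin -massE -lambda_oc// le_lambda//; exact: subIsetr.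
Qed.

(** Carathéodory's condition for the interval ]a, b] splits any set. *)
Lemma massD E a b c : a <= b -> b <= c ->
  mass E a c = mass E a b + mass E b c.
Proof.
move=> ab bc; apply: EFin_inj; rewrite EFinD -!massE.
have mab : measurable (`]a, b] : set (lebesgueR R)) := measurable_itvL _.
rewrite [LHS](mab (E `&` `]a, c])) -!setIA; congr (lambda (_ `&` _) + lambda (_ `&` _))%E.
  by apply/seteqP; split => y; rewrite /setI /mkset /= !in_itv /= => *; lra.
by apply/seteqP; split => y; rewrite /setC /setI /mkset /= !in_itv /= => *; lra.
Qed.

Lemma lambda_cc E a b : a <= b -> lambda (E `&` `[a, b]) = (mass E a b)%:E.
Proof.
move=> ab; rewrite -massE; apply/eqP; rewrite eq_le; apply/andP; split.
  apply: (@le_trans _ _ (lambda ((E `&` `]a, b]) `|` `[a, a]))).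
    apply: le_lambda => y [Ey]; rewrite /mkset !in_itv /= => /andP[ay yb].
    have [<-|ya] := eqVneq a y; [right|left; split => //].
      by rewrite /= in_itv /= lexx.
    by rewrite /mkset in_itv /= lt_neqAle ya ay yb.
  apply: le_trans (outer_measureU2 ((@wlength R idfun)^*)%mu _ _) _.
  rewrite [X in (_ + X)%E](_ : _ = 0%E) ?adde0//.
  by rewrite -[LHS]/(lambda `[a, a]) lambda_itv /= ltxx.
apply: le_lambda => y [Ey]; rewrite /mkset !in_itv /= => /andP[ay yb]; split => //.
by rewrite /= in_itv /= (ltW ay).
Qed.

(** For a cover of E ∩ ]a, b] by half-open intervals of total length S, adding
    up the density bounds gives |E ∩ ]a, b]| <= theta * S; letting S approach
    the outer measure gives |E ∩ ]a, b]| <= theta * |E ∩ ]a, b]|. *)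
Lemma density_lt1_null E a b (theta : R) : 0 < theta < 1 ->
  (forall u v, a <= u -> u <= v -> v <= b ->
     (lambda (E `&` `]u, v]) <= (theta * (v - u))%:E)%E) ->
  lambda (E `&` `]a, b]) = 0%E.
Proof.
move=> /andP[t0 t1] Edens; set L := lambda _.
have Lfin : L \is a fin_num := lambda_setI_itv_fin E a b.
have L0 : (0 <= L)%E := lambda_ge0 _.
suff : (theta^-1%:E * L <= L)%E.
  move: L0; rewrite -(fineK Lfin) -EFinM !lee_fin => L0.
  rewrite mulrC ler_pdivrMr// => Ltheta; congr EFin.
  by nra.
apply: le_ereal_inf_tmp => _ [F [mF EF] <-].
rewrite muleC lee_pdivrMr// muleC.
rewrite -nneseriesZl; last by move=> k _; exact: (wlength_ge0 idfun).
apply: (@le_trans _ _ (\sum_(0 <= k <oo) lambda (F k `&` (E `&` `]a, b])))%E).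
  apply: le_trans (outer_measure_sigma_subadditive ((@wlength R idfun)^*)%mu _).
  apply: le_lambda; rewrite -setI_bigcupl => y Ey; split => //; exact: EF.
apply: lee_nneseries => [k _ _|k _]; first exact: lambda_ge0.
have [p _ <-] := mF k.
have := wlength_itv idfun `]p.1, p.2]; rewrite /= lte_fin => ->.
have sub : `]p.1, p.2] `&` (E `&` `]a, b]) `<=` E `&` `]Num.max p.1 a, Num.min p.2 b].
  move=> y [+ [Ey +]]; rewrite /mkset !in_itv /= => /andP[py yp] /andP[ay yb]; split => //=.
  by rewrite in_itv /= gt_max le_min py ay yp yb.
apply: le_trans (le_lambda sub) _.
have [uv|vu] := leP (Num.max p.1 a) (Num.min p.2 b).
  apply: le_trans (Edens _ _ _ uv _) _.
  - by rewrite le_max lexx orbT.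
  - by rewrite ge_min lexx orbT.
  have pp : p.1 <= p.2 by move: uv; rewrite ge_max !le_min => /andP[/andP[]].
  have m1 : p.1 <= Num.max p.1 a by rewrite le_max lexx.
  have m2 : Num.min p.2 b <= p.2 by rewrite ge_min lexx.
  case: ltgtP pp => // [pp _|pp _]; rewrite ?mule0 -?EFinN -?EFinD -?EFinM lee_fin.
    by rewrite ler_pM2l// lerB.
  by rewrite pmulr_rle0//; lra.
apply: (@le_trans _ _ 0%E).
  apply: le_trans (le_lambda (@subIsetr _ _ _)) _.
  by rewrite lambda_itv /= lte_fin ltNge (ltW vu).
by case: ifP => pp; rewrite ?mule0// -?EFinN -?EFinD -?EFinM lee_fin mulr_ge0 ?ltW// subr_gt0.
Qed.

(** The witness is an interior extremum of h(t) = |E ∩ ]a, t]| - t/2: at such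
    a point E has density at least 1/2 on one side and at most 1/2 on the
    other. *)
Lemma intermediate_density E a b : measurable E ->
  lambda (E `&` `]a, b]) <> 0%E -> lambda (~` E `&` `]a, b]) <> 0%E ->
  exists z s0, [/\ a < z < b, 0 < s0 & forall s, 0 < s <= s0 ->
    s / 2 <= mass E (z - s) (z + s) <= 3 / 2 * s].
Proof.
move=> mE E0 CE0.
have half F : lambda (F `&` `]a, b]) <> 0%E -> exists u v, [/\ a <= u, u < v, v <= b & (v - u) / 2 < mass F u v].
  move=> F0; apply: contrapT => noF; apply: F0; apply: (@density_lt1_null F a b 2^-1); first by lra.
  move=> u v au uv vb; rewrite massE lee_fin leNgt; apply/negP => muv; apply: noF.
  exists u, v; split => //; last by lra.
  rewrite lt_neqAle uv andbT; apply/eqP => uvE; move: muv.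
  by have := mass_le F uv; rewrite uvE; lra.
have mCE : measurable (~` E) by exact: measurableC.
have [u [v [au uv vb Euv]]] := half _ E0.
have [u' [v' [au' uv' vb' CEuv]]] := half _ CE0.
pose h t := mass E a t - 2^-1 * t.
have hD s t : a <= s -> s <= t -> h t = h s + (mass E s t - 2^-1 * (t - s)).
  by move=> as_ st; rewrite /h (massD _ as_ st); ring.
have hc : {within `[a, b], continuous h}.
  apply: lipschitz_within_continuous => s t as_ st tb; rewrite (hD s t as_ st).
  have := mass_le E st; have := mass_ge0 E s t.
  by move=> ? ?; rewrite ler_norml; apply/andP; split; lra.
case: (@nonmonotone_local_extremum _ h a b u v u' v' hc au uv vb _ au' uv' vb' _).
- by rewrite (hD u v)// ?ltW//; lra.
- by rewrite (hD u' v')// ?ltW//; have := mass_setC mE (ltW uv'); lra.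
move=> p [z [q [ap pz zq qb ext]]]; exists z, (Num.min (z - p) (q - z)); split.
- by apply/andP; split; lra.
- by rewrite lt_min; apply/andP; split; lra.
move=> s /andP[s0]; rewrite le_min => /andP[szp sqz].
have zsz : z - s <= z by lra.
have zzs : z <= z + s by lra.
rewrite (massD E zsz zzs).
have hl : h z = h (z - s) + (mass E (z - s) z - 2^-1 * (z - (z - s))) by apply: hD; lra.
have hr : h (z + s) = h z + (mass E z (z + s) - 2^-1 * (z + s - z)) by apply: hD; lra.
have := mass_le E zsz; have := mass_le E zzs.
have := mass_ge0 E (z - s) z; have := mass_ge0 E z (z + s).
have lp : p <= z - s <= q by apply/andP; split; lra.
have rp : p <= z + s <= q by apply/andP; split; lra.
by case: ext => ext; have := ext _ lp; have := ext _ rp; move=> *; apply/andP; split; lra.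
Qed.

(** * Averages and the maximal function *)

(** Centring the interval of integration at x makes averages around different
    points comparable. *)
Lemma avgE (g : R -> R) x s :
  measurable_fun [set: lebesgueR R] (g : lebesgueR R -> R) -> (forall t, 0 <= g t) ->
  avg g x s =
    ((2 * s)^-1%:E * \int[lambda]_(y in `[(x - s)%R, (x + s)%R]) (g y)%:E)%E.
Proof. by move=> mg g0; rewrite /avg integral_shift. Qed.

Lemma avg_ge_mass (g : R -> R) E (k : R) x s :
  measurable_fun [set: lebesgueR R] (g : lebesgueR R -> R) -> (forall t, 0 <= g t) ->
  measurable E -> 0 <= k -> (forall t, E t -> k <= g t) -> 0 < s ->
  ((k * mass E (x - s) (x + s) / (2 * s))%:E <= avg g x s)%E.
Proof.
move=> mg g0 mE k0 Eg s0; rewrite avgE// mulrC EFinM.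
apply: lee_wpmul2l; first by rewrite lee_fin invr_ge0 mulr_ge0// ltW.
have ss : x - s <= x + s by lra.
have mI : measurable (`[x - s, x + s] : set (lebesgueR R)) := measurable_itvL _.
have mEI := measurableI _ _ mE mI.
rewrite EFinM -(lambda_cc E ss) -(integral_cst lambda mEI).
apply: (@le_trans _ _ (\int[lambda]_(y in E `&` `[(x - s)%R, (x + s)%R]) (g y)%:E)%E).
  apply: ge0_le_integral.
  - exact: mEI.
  - by move=> y _; rewrite /cst lee_fin.
  - exact: measurable_cst.
  - by apply/measurable_EFinP; exact: measurable_funTS.
  - by move=> y [Ey _]; rewrite /cst lee_fin; exact: Eg.
apply: ge0_subset_integral => //.
- by apply/measurable_EFinP; exact: measurable_funTS.
- by move=> y _; rewrite lee_fin.
Qed.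

Lemma avg_ge0 (g : R -> R) x s : (forall t, 0 <= g t) -> 0 < s -> (0 <= avg g x s)%E.
Proof.
move=> g0 s0; apply: mule_ge0; first by rewrite lee_fin invr_ge0 mulr_ge0// ltW.
by apply: integral_ge0 => y _; rewrite lee_fin.
Qed.

Lemma avg_le_maximal (f : R -> R) x s : 0 < s ->
  (avg (fun t => `|f t|%R) x s <= maximal f x)%E.
Proof. by move=> s0; apply: ereal_sup_ubound; exists s. Qed.

Lemma maximal_ge0 (f : R -> R) x : (0 <= maximal f x)%E.
Proof.
by apply: le_trans (avg_le_maximal f x (@ltr01 R)); exact: avg_ge0.
Qed.

(** The interval [z - s, z + s] is contained in the one of centre z' and radius
    s + |z - z'|; the factor compensates the change of normalisation, and is
    uniform over the radii s >= rho. *)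
Lemma avg_perturb (g : R -> R) z z' s (rho : R) :
  measurable_fun [set: lebesgueR R] (g : lebesgueR R -> R) -> (forall t, 0 <= g t) ->
  0 < rho -> rho <= s ->
  (avg g z s <= (1 + `|z - z'| / rho)%:E * avg g z' (s + `|z - z'|)%R)%E.
Proof.
move=> mg g0 rho0 rs; set d := `|z - z'|; have d0 : 0 <= d by exact: normr_ge0.
have s0 : 0 < s by lra.
have mI a b : measurable (`[a, b] : set (lebesgueR R)) by exact: measurable_itvL.
rewrite !avgE// muleA -EFinM.
apply: (@le_trans _ _ ((2 * s)^-1%:E *
    \int[lambda]_(y in `[(z' - (s + d))%R, (z' + (s + d))%R]) (g y)%:E)%E).
  apply: lee_wpmul2l; first by rewrite lee_fin invr_ge0 mulr_ge0// ltW.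
  apply: ge0_subset_integral.
  - exact: mI.
  - exact: mI.
  - by apply/measurable_EFinP; exact: measurable_funTS.
  - by move=> y _; rewrite lee_fin.
  - have := ler_norm (z - z'); have := ler_norm (z' - z); rewrite (distrC z') -/d => ? ?.
    by move=> y; rewrite /mkset !in_itv /= => /andP[? ?]; apply/andP; split; lra.
apply: lee_wpmul2r; first by apply: integral_ge0 => y _; rewrite lee_fin.
rewrite lee_fin ler_pdivlMr; last by lra.
rewrite mulrC ler_pdivrMr ?mulr_gt0//.
have : d <= d / rho * s by rewrite mulrAC ler_pdivlMr// ler_wpM2l.
nra.
Qed.

(** * Discontinuities near a non-Lebesgue point of a characteristic function *)

Lemma avg_indic A x s : measurable A -> 0 < s ->
  avg (\1_A : R -> R) x s = (mass A (x - s) (x + s) / (2 * s))%:E.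
Proof.
move=> mA s0; rewrite avgE//.
rewrite integral_indic//; last exact: measurable_itvL.
have ss : x - s <= x + s by lra.
by rewrite [X in (_ * X)%E](lambda_cc A ss) -EFinM mulrC.
Qed.

Lemma norm_indic A : (fun t => `|(\1_A : R -> R) t|) = \1_A.
Proof. by apply/funext => t; rewrite ger0_norm. Qed.

Lemma avg_null_cvg A x d : measurable A -> 0 < d ->
  lambda (A `&` `]x - d, x + d]) = 0%E ->
  avg (\1_A : R -> R) x s @[s --> 0^'+] --> 0%E.
Proof.
move=> mA d0 A0; apply: cvg_near_cst; near=> s.
have s0 : 0 < s by [].
have sd : s < d by near: s; exact: nbhs_right_lt.
rewrite avg_indic//; suff -> : mass A (x - s) (x + s) = 0 by rewrite mul0r.
apply/eqP; rewrite eq_le mass_ge0 andbT.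
suff : (lambda (A `&` `](x - s)%R, (x + s)%R]) <= 0)%E by rewrite massE.
rewrite -A0; apply: le_lambda.
move=> y [Ay]; rewrite /mkset !in_itv /= => /andP[? ?]; split => //.
by rewrite /= in_itv /=; apply/andP; split; lra.
Unshelve. all: by end_near.
Qed.

Lemma lebesgue_point_null A x d : measurable A -> 0 < d ->
  lambda (A `&` `]x - d, x + d]) = 0%E -> lebesgue_point (\1_A : R -> R) x.
Proof.
move=> mA d0 A0; exists 0; under [X in avg X]eq_fun do rewrite subr0.
by rewrite norm_indic; exact: avg_null_cvg A0.
Qed.

Lemma lebesgue_point_conull A x d : measurable A -> 0 < d ->
  lambda (~` A `&` `]x - d, x + d]) = 0%E -> lebesgue_point (\1_A : R -> R) x.
Proof.
move=> mA d0 A0; exists 1.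
rewrite [X in avg X](_ : _ = \1_(~` A)); first by apply: avg_null_cvg A0 => //; exact: measurableC.
apply/funext => t; rewrite !indicE in_setC; case: (t \in A); first by rewrite subrr normr0.
by rewrite sub0r normrN1.
Qed.

Lemma lambda_L1 A : measurable A -> L1 (\1_A : R -> R) -> (lambda A < +oo)%E.
Proof.
move=> mA /integrableP[_].
under eq_integral do rewrite /= ger0_norm//.
by rewrite integral_indic// setIT.
Qed.

(** With L a bound for |A|: radii at least L give averages at most 1/2; for a
    radius s in [s0, L], the interval contains measure at least s0/2 of the
    complement of A, so the average is at most
    1 - s0 / (4 s) <= 1 - s0 / (4 L). *)
Lemma maximal_indic_lt1 A z s0 : measurable A -> L1 (\1_A : R -> R) -> 0 < s0 ->
  (forall s, 0 < s <= s0 -> mass A (z - s) (z + s) <= 3 / 2 * s) ->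
  exists2 theta : R, theta < 1 & (maximal (\1_A : R -> R) z <= theta%:E)%E.
Proof.
move=> mA LA s00 dens; have Afin := lambda_L1 mA LA.
have [L L0 AL] : exists2 L : R, 0 < L & (lambda A <= L%:E)%E.
  exists (fine (lambda A) + 1).
    by rewrite ltr_wpDl// fine_ge0// lambda_ge0.
  rewrite EFinD fineK ?ge0_fin_numE ?lambda_ge0//.
  by rewrite leeDl// lee_fin.
exists (Num.max (3 / 4) (1 - s0 / (4 * L))).
  by rewrite gt_max ltrBlDr ltrDl divr_gt0 ?mulr_gt0// andbT; lra.
apply: ge_ereal_sup => _ [s /= sp <-]; rewrite norm_indic avg_indic// lee_fin.
rewrite le_max ler_pdivrMr ?mulr_gt0// ler_pdivrMr ?mulr_gt0//.
have [ss0|ss0] := leP s s0.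
  by apply/orP; left; have := dens s; rewrite sp ss0 => /(_ isT); lra.
have [Ls|sL] := leP L s.
  apply/orP; left; suff : mass A (z - s) (z + s) <= L by lra.
  by rewrite -lee_fin -massE (le_trans _ AL)//; apply: le_lambda; exact: subIsetl.
apply/orP; right.
have h1 : z - s <= z - s0 by lra.
have h2 : z - s0 <= z + s0 by lra.
have h3 : z + s0 <= z + s by lra.
rewrite (massD A h1 (le_trans h2 h3)) (massD A h2 h3).
have := mass_le A h1; have := mass_le A h3.
have := dens s0; rewrite s00 lexx => /(_ isT).
have : s0 / (4 * L) * (2 * s) <= s0 / 2.
  by rewrite mulrAC ler_pdivrMr ?mulr_gt0//; nra.
lra.
Qed.

Lemma maximal_indic_discontinuous A x r : measurable A -> L1 (\1_A : R -> R) ->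
  ~ lebesgue_point (\1_A : R -> R) x -> 0 < r ->
  exists2 y, y \in `]x - r, x + r[ & ~ {for y, continuous (maximal (\1_A : R -> R))}.
Proof.
move=> mA LA nleb r0; set d := r / 2; have d0 : 0 < d by rewrite /d; lra.
have A0 : lambda (A `&` `]x - d, x + d]) <> 0%E.
  by move=> /(lebesgue_point_null mA d0).
have CA0 : lambda (~` A `&` `]x - d, x + d]) <> 0%E.
  by move=> /(lebesgue_point_conull mA d0).
have [z [s0 [/andP[xz zx] s00 dens]]] := intermediate_density mA A0 CA0.
exists z; first by rewrite in_itv /=; apply/andP; split; rewrite /d in xz zx; lra.
move=> cz; have [t0 t01 Mz] : exists2 t, t < 1 & (maximal (\1_A : R -> R) z <= t%:E)%E.
  apply: maximal_indic_lt1 s00 _ => // s ss0; by have /andP[] := dens _ ss0.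
(* The maximum with 1/2 ensures that the threshold is positive. *)
pose th := Num.max 2^-1 ((1 + t0) / 2).
have th01 : 0 < th < 1 by rewrite /th lt_max gt_max; apply/andP; split; lra.
have : nbhs (maximal (\1_A : R -> R) z) [set e | (e < th%:E)%E].
  apply: open_nbhs_nbhs; split; first exact: open_ereal_lt_ereal.
  apply: (le_lt_trans Mz); rewrite lte_fin /th lt_max; apply/orP; right; lra.
move=> /cz /nbhs_ballP[e /= e0 Mth].
pose k := Num.min (e / 2) s0.
have k0 : 0 < k by rewrite lt_min s00 andbT; lra.
have := dens k; rewrite k0 ge_min lexx orbT => /(_ isT) /andP[+ _].
suff -> : mass A (z - k) (z + k) = 0 by lra.
apply: EFin_inj; rewrite -massE; apply: (density_lt1_null th01) => u v ku uv vk.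
rewrite massE lee_fin.
have [->|uv'] := eqVneq u v; first by have := mass_le A (lexx v); rewrite subrr mulr0.
have uvlt : u < v by rewrite lt_neqAle uv' uv.
have s2 : 0 < (v - u) / 2 by lra.
have : ball z e ((u + v) / 2).
  have : k <= e / 2 by rewrite /k ge_min lexx.
  rewrite /ball /= => ke; rewrite ltr_norml; apply/andP; split; lra.
move=> /Mth /= /ltW; rewrite leNgt => /negP hM; rewrite leNgt; apply/negP => hm; apply: hM.
apply: (@lt_le_trans _ _ (avg (\1_A : R -> R) ((u + v) / 2) ((v - u) / 2))).
  rewrite avg_indic// lte_fin.
  rewrite (_ : (u + v) / 2 - (v - u) / 2 = u); last by lra.
  rewrite (_ : (u + v) / 2 + (v - u) / 2 = v); last by lra.
  by rewrite ltr_pdivlMr ?mulr_gt0//; lra.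
by apply: ereal_sup_ubound; exists ((v - u) / 2) => //; rewrite norm_indic.
Qed.

(** * Simple functions all of whose points are Lebesgue points *)

Lemma seq_separation (l : seq R) (c : R) :
  exists2 d : R, 0 < d & forall y, y \in l -> y != c -> d <= `|y - c|.
Proof.
elim: l => [|w l [d d0 dl]]; first by exists 1.
have [wc|wc] := eqVneq w c.
  by exists d => // y; rewrite inE => /predU1P[->|]; [rewrite wc eqxx|exact: dl].
exists (Num.min d `|w - c|).
  by rewrite lt_min d0 normr_gt0 subr_eq0.
move=> y; rewrite inE => /predU1P[->|yl] yc; first by rewrite ge_min lexx orbT.
by rewrite ge_min dl.
Qed.

Lemma measurable_dist (f : {sfun lebesgueR R >-> R}) (c : R) :
  measurable_fun [set: lebesgueR R] ((fun t => `|f t - c|) : lebesgueR R -> R).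
Proof.
apply: (measurableT_comp (@normr_measurable R setT)).
by apply: measurable_funB.
Qed.

Lemma measurable_level (f : {sfun lebesgueR R >-> R}) (c : R) :
  measurable (f @^-1` [set c] : set (lebesgueR R)).
Proof. by []. Qed.

(** At a point of intermediate density of the level set E = {f = c}, whatever
    the constant c', f stays at distance at least d/2 from c' either on E or on its
    complement, d being the gap between c and the other values of f.  Each of
    them fills at least a quarter of the small intervals, so the averages of
    |f - c'| stay above d/8 and cannot tend to 0. *)
Lemma null_or_conull_level (f : {sfun lebesgueR R >-> R}) (c : R) a b :
  (forall y, a < y < b -> lebesgue_point f y) ->
  lambda (f @^-1` [set c] `&` `]a, b]) <> 0%E ->
  lambda (~` (f @^-1` [set c]) `&` `]a, b]) = 0%E.
Proof.
move=> leb; set E := f @^-1` [set c] => E0; apply: contrapT => CE0.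
have mE : measurable (E : set (lebesgueR R)) := measurable_level f c.
have mCE : measurable (~` E : set (lebesgueR R)) by exact: measurableC.
have [z [s0 [zab s00 dens]]] := intermediate_density mE E0 CE0.
have [c' limz] := leb z zab.
have [d d0 sep] : exists2 d, 0 < d & forall t, f t <> c -> d <= `|f t - c|.
  have /finite_seqP[l fl] := fimfunP f.
  have [d d0 dl] := seq_separation l c; exists d => // t /eqP ftc.
  apply: dl => //; have : range f (f t) by exists t.
  by rewrite fl.
have [E' mE' [E'k E'd]] : exists2 E' : set (lebesgueR R), measurable E' &
    (forall t, E' t -> d / 2 <= `|f t - c'|) /\
    (forall s, 0 < s <= s0 -> s / 2 <= mass E' (z - s) (z + s)).
  have [cc|cc] := ltP `|c' - c| (d / 2).
    exists (~` E) => //; split => [t /sep fd|s ss].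
      by have := ler_distD c' (f t) c; lra.
    have /andP[_] := dens _ ss; have := @mass_setC E (z - s) (z + s) mE.
    by move: ss => /andP[? ?] /(_ ltac:(lra)); lra.
  exists E => //; split => [t ->|s /dens/andP[]//].
  by rewrite distrC.
have near0 : \forall s \near 0^'+, (avg (fun t => (`|f t - c'|)%R) z s < (d / 8)%:E)%E.
  have : nbhs (0%E : \bar R) [set e | (e < (d / 8)%:E)%E].
    apply: open_nbhs_nbhs; split; first exact: open_ereal_lt_ereal.
    by rewrite /= lte_fin; lra.
  by move=> /limz.
near (0 : R)^'+ => s.
have sp : 0 < s by [].
have ss : 0 < s <= s0 by rewrite sp /=; near: s; exact: nbhs_right_le.
have : (avg (fun t => (`|f t - c'|)%R) z s < (d / 8)%:E)%E by near: s.
rewrite ltNge => /negP; apply.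
apply: le_trans (avg_ge_mass z (measurable_dist f c') (fun=> normr_ge0 _) mE' _ E'k sp); last by lra.
have := E'd _ ss; rewrite lee_fin ler_pdivlMr ?mulr_gt0// => m.
have : d / 2 * (s / 2) <= d / 2 * mass E' (z - s) (z + s) by rewrite ler_pM2l//; lra.
by lra.
Unshelve. all: by end_near.
Qed.

(** Finitely many null sets cannot cover an interval of positive length. *)
Lemma exists_level_nonnull (f : {sfun lebesgueR R >-> R}) a b : a < b ->
  exists c, lambda (f @^-1` [set c] `&` `]a, b]) <> 0%E.
Proof.
move=> ab; apply: contrapT => /forallNP nolev.
have {}nolev c : lambda (f @^-1` [set c] `&` `]a, b]) = 0%E by exact: contrapT (nolev c).
have null (l : seq R) : lambda ([set t | f t \in l] `&` `]a, b]) = 0%E.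
  elim: l => [|w l IH].
    by rewrite (_ : _ `&` _ = set0) ?measure0//; apply/seteqP; split => // t [].
  apply/eqP; rewrite eq_le lambda_ge0 andbT.
  apply: (@le_trans _ _ (lambda ((f @^-1` [set w] `&` `]a, b]) `|` ([set t | f t \in l] `&` `]a, b])))).
    apply: le_lambda => t [/=]; rewrite inE => /predU1P[tw|tl] tab; first by left.
    by right.
  apply: le_trans (outer_measureU2 ((@wlength R idfun)^*)%mu _ _) _.
  by rewrite [X in (X + _)%E]nolev [X in (_ + X)%E]IH adde0.
have /finite_seqP[l fl] := fimfunP f.
have := null l; rewrite (_ : [set t | _] = setT).
  by rewrite setTI lambda_oc ?ltW// => -[]; lra.
apply/seteqP; split => // t _; have : range f (f t) by exists t.
by rewrite fl.
Qed.

Lemma locally_ae_constant (f : {sfun lebesgueR R >-> R}) a b : a < b ->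
  (forall y, a < y < b -> lebesgue_point f y) ->
  exists c, lambda (~` (f @^-1` [set c]) `&` `]a, b]) = 0%E.
Proof.
move=> ab leb; have [c fc] := exists_level_nonnull f ab.
by exists c; exact: null_or_conull_level.
Qed.

(** * Continuity of the maximal function where the function is a.e. constant *)

Section LocallyConstant.
Variables (f : {sfun lebesgueR R >-> R}) (c x rho : R).
Hypotheses (rho0 : 0 < rho) (Lf : L1 f).
Hypothesis fc : lambda (~` (f @^-1` [set c]) `&` `]x - 2 * rho, x + 2 * rho]) = 0%E.

Let mf : measurable_fun [set: lebesgueR R] ((fun t => `|f t|) : lebesgueR R -> R).
Proof. exact: (measurableT_comp (@normr_measurable R setT)). Qed.

Lemma avg_locally_constant z s : `|z - x| < rho -> 0 < s -> s < rho ->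
  avg (fun t => `|f t|) z s = `|c|%:E.
Proof.
move=> zx s0 srho; rewrite avgE//.
have mI : measurable (`[z - s, z + s] : set (lebesgueR R)) by exact: measurable_itvL.
set N : set (lebesgueR R) := ~` (f @^-1` [set c]) `&` `]x - 2 * rho, x + 2 * rho].
have mN : measurable N.
  apply: measurableI; last exact: measurable_itvL.
  by apply: measurableC; exact: measurable_level.
rewrite (ge0_negligible_integral mN mI _ _ fc); last 2 first.
- by apply/measurable_EFinP; exact: measurable_funTS.
- by move=> y _; rewrite lee_fin.
rewrite (eq_integral (cst `|c|%:E)); last first.
  move=> y /set_mem[]; rewrite /mkset in_itv /= => /andP[? ?] nN.
  suff -> : f y = c by [].
  apply: contrapT => fyc; apply: nN; split => //.
  rewrite /mkset in_itv /=; move: zx; rewrite ltr_norml => /andP[? ?].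
  by apply/andP; split; lra.
rewrite -(ge0_negligible_integral mN mI _ _ fc); last 2 first.
- exact: measurable_cst.
- by move=> y _; rewrite /cst lee_fin.
rewrite (integral_cst lambda mI) [X in (_ * (_ * X))%E]lambda_itv /= lte_fin ifT; last by lra.
rewrite -EFinB -!EFinM; congr EFin.
by rewrite (_ : z + s - (z - s) = 2 * s); [rewrite mulrCA mulVf ?mulr1//|]; lra.
Qed.

(** Radii below rho give the common value |c| at z and z', and the others are
    handled by [avg_perturb]. *)
Lemma maximal_perturb z z' : `|z - x| < rho -> `|z' - x| < rho ->
  (maximal f z <= (1 + `|z - z'| / rho)%:E * maximal f z')%E.
Proof.
move=> zx z'x; apply: ge_ereal_sup => _ [s /= s0 <-].
have d0 : 0 <= `|z - z'| / rho by rewrite divr_ge0// ltW.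
have [rs|sr] := leP rho s.
  apply: le_trans (avg_perturb z z' mf _ rho0 rs) _; first by [].
  apply: lee_wpmul2l; first by rewrite lee_fin; lra.
  by apply: avg_le_maximal; rewrite ltr_wpDr.
rewrite avg_locally_constant// -(avg_locally_constant z'x s0 sr).
apply: le_trans (avg_le_maximal f z' s0) _.
by rewrite -[leLHS]mul1e lee_wpmul2r ?maximal_ge0// lee_fin lerDl.
Qed.

Lemma maximal_fin z : `|z - x| < rho -> maximal f z \is a fin_num.
Proof.
move=> zx; rewrite ge0_fin_numE ?maximal_ge0//.
have /integrableP[_ Loo] := Lf.
set I := integral _ _ _ in Loo.
have I0 : (0 <= I)%E by apply: integral_ge0 => y _; exact: abse_ge0.
have Ifin : I \is a fin_num by rewrite ge0_fin_numE.
apply: (@le_lt_trans _ _ (`|c|%:E + ((2 * rho)^-1%:E * I))%E); last first.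
  by rewrite -(fineK Ifin) -EFinM -EFinD ltry.
have K0 : (0 <= ((2 * rho)^-1)%:E * I)%E.
  by apply: mule_ge0 => //; rewrite lee_fin invr_ge0 mulr_ge0 ?(ltW rho0).
apply: ge_ereal_sup => _ [s /= s0 <-].
have [rs|sr] := leP rho s; last by rewrite avg_locally_constant// leeDl.
apply: (@le_trans _ _ ((2 * rho)^-1%:E * I)%E); last by rewrite leeDr.
rewrite avgE//; apply: lee_pmul.
- by rewrite lee_fin invr_ge0; lra.
- by apply: integral_ge0 => y _; rewrite lee_fin.
- have s1 : 0 < s := s0. have rho1 : 0 < rho := rho0.
  by rewrite lee_fin lef_pV2 ?posrE; lra.
apply: ge0_subset_integral.
- exact: measurable_itvL.
- exact: measurableT.
- by apply/measurable_EFinP.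
- by move=> y _; rewrite lee_fin.
- exact: subsetT.
Qed.

Lemma maximal_continuous_at : {for x, continuous (maximal f)}.
Proof.
have xx : `|x - x| < rho by rewrite subrr normr0.
suff : maximal f @ x --> maximal f x by [].
rewrite -(fineK (maximal_fin xx)); apply/fine_cvgP; split.
  near=> z; apply: maximal_fin; near: z.
  by exists rho => //= z; rewrite /ball /= distrC.
set m := fine (maximal f x).
have m0 : 0 <= m by apply: fine_ge0; exact: maximal_ge0.
apply/cvgrPdist_le => e e0.
near=> z.
have zx : `|z - x| < rho.
  near: z; by exists rho => //= z; rewrite /ball /= distrC.
have ze : `|z - x| <= rho * e / (2 * m + 1).
  near: z; exists (rho * e / (2 * m + 1)) => /=; last first.
    by move=> z; rewrite /ball /= distrC => /ltW.
  by rewrite divr_gt0 ?mulr_gt0//; lra.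
have := maximal_perturb zx xx; have := maximal_perturb xx zx.
rewrite -(fineK (maximal_fin xx)) -(fineK (maximal_fin zx)) -!EFinM !lee_fin -/m.
set mz := fine (maximal f z); rewrite [`|x - z|]distrC => h1 h2 /=.
set k := `|z - x| / rho in h1 h2.
have k0 : 0 <= k by rewrite divr_ge0// ltW.
have k1 : k <= 1 by rewrite ler_pdivrMr// mul1r ltW.
(* As k <= 1, the two inequalities give mz <= 2 m, then |m - mz| <= 2 k m; the
   summand 1 avoids a division by zero when m = 0. *)
have ke : k * (2 * m + 1) <= e.
  rewrite /k mulrAC ler_pdivrMr// -ler_pdivlMr; last by lra.
  by rewrite [e * _]mulrC.
rewrite -/mz ler_norml; apply/andP; split; nra.
Unshelve. all: by end_near.
Qed.

End LocallyConstant.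

Lemma maximal_simple_discontinuous (f : {sfun lebesgueR R >-> R}) x r : L1 f ->
  ~ {for x, continuous (maximal f)} -> 0 < r ->
  exists2 y, y \in `]x - r, x + r[ & ~ lebesgue_point f y.
Proof.
move=> Lf ncont r0; apply: contrapT => noy; apply: ncont.
have [|y yI|c fc] := @locally_ae_constant f (x - 2 * (r / 4)) (x + 2 * (r / 4)).
- by lra.
- apply: contrapT => nleb; apply: noy; exists y => //.
  by rewrite in_itv /=; move: yI => /andP[? ?]; apply/andP; split; lra.
- by apply: maximal_continuous_at fc => //; lra.
Qed.

End MaximalFunction.

Theorem theorem6 (R : realType) :
  (forall f : {sfun lebesgueR R >-> R}, L1 f ->
     forall x : R, ~ {for x, continuous (maximal f)} ->
     forall r : R, 0 < r ->
     exists2 y : R, y \in `]x - r, x + r[ & ~ lebesgue_point f y)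
  /\
  (forall A : set (lebesgueR R), measurable A ->
     L1 (\1_A : R -> R) ->
     forall x : R, ~ lebesgue_point (\1_A : R -> R) x ->
     forall r : R, 0 < r ->
     exists2 y : R, y \in `]x - r, x + r[ &
       ~ {for y, continuous (maximal (\1_A : R -> R))}).
Proof.
split=> [f Lf x ncont r r0|A mA LA x nleb r r0].
  exact: maximal_simple_discontinuous.
exact: maximal_indic_discontinuous.
Qed.
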